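(* Let $K$ be a commutative field of characteristic $\ne2$, let $(A,\omega)$ be a weighted (baric) $K$-algebra and let $f\in(K(\mathcal T),\cdot,\star)$ be an identity verified by $(A,\omega)$. If $\operatorname{card}(K^{*})>\max\{|f|_i : i\ge1\}$, then each homogeneous component of $f$ is an identity verified by $A$.
   Context: A weighted (baric) $K$-algebra $(A,\omega)$ is a commutative, not necessarily associative $K$-algebra $A$ with a nonzero algebra morphism $\omega:A\to K$. $\mathcal T=\{t_n : n\ge1\}$ is a countable set of letters; $\mathfrak M(\mathcal T)$ is the free commutative magma on $\mathcal T$ (commutative nonassociative monomials) with product $\cdot$. $(\mathfrak M(\mathcal T),\cdot,\star)$ is the algebraic system generated by $\mathcal T$ with the commutative operation $\cdot$ and a second, noncommutative binary operation $\star$ subject to $(u\star v)\star w=u\star(v\star w)=(u\cdot v)\star w$; $(u\star v)\cdot w=u\star(v\cdot w)=v\cdot(u\star w)$; $(u\star v)\cdot(u'\star v')=(u\cdot u')\star(v\cdot v')$; $(u\star v)\star(u'\star v')=(u\cdot v)\star(u'\star v')$. Each of its elements is either some $w\in\mathfrak M(\mathcal T)$ or of the form $u\star v$ with $u,v\in\mathfrak M(\mathcal T)$. $(K(\mathcal T),\cdot,\star)$ is the $K$-vector space spanned by this system (operations extended bilinearly), so its elements are finite sums $\sum_i\alpha_iw_i+\sum_j\beta_j\,u_j\star v_j$ with $w_i,u_j,v_j\in\mathfrak M(\mathcal T)$. Degrees: $|w|_i$ is the number of occurrences of $t_i$ in $w$, $|u\star v|_i=|u|_i+|v|_i$; the type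 of a term is the sequence of its degrees in $t_1,t_2,\dots$; $|f|_i$ is the maximum of the degrees in $t_i$ of the terms of $f$. The homogeneous component of $f$ of a given type is the sum of all its terms of that type. For $\varrho:\mathcal T\to A$, $\widehat\varrho:(K(\mathcal T),\cdot,\star)\to A$ is the linear map extending $\varrho$ with $\widehat\varrho(u\cdot v)=\widehat\varrho(u)\widehat\varrho(v)$ and $\widehat\varrho(u\star v)=\omega(\widehat\varrho(u))\,\widehat\varrho(v)$. $(A,\omega)$ verifies the identity $f$ if $\widehat\varrho(f)=0$ for every map $\varrho:\mathcal T\to A$. *)

(* Defs.v *)
From HB Require Import structures.
From mathcomp Require Import all_boot all_order all_algebra.
From mathcomp Require Import generic_quotient finmap monalg.
From mathcomp Require Import boolp classical_sets cardinality.

Set Implicit Arguments.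
Unset Strict Implicit.
Unset Printing Implicit Defensive.

Import GRing.Theory.
Local Open Scope ring_scope.
Local Open Scope quotient_scope.

(* The letters t_1, t_2, ... are indexed by nat: index i stands for t_(i+1).
   The free commutative magma is the quotient of binary trees by commutativity
   at every node. *)

Inductive tree : Type := Leaf of nat | Node of tree & tree.

Fixpoint tree_encode (t : tree) : GenTree.tree nat :=
  match t with
  | Leaf i => GenTree.Leaf i
  | Node a b => GenTree.Node 0 [:: tree_encode a; tree_encode b]
  end.

Fixpoint tree_decode (t : GenTree.tree nat) : tree :=
  match t with
  | GenTree.Leaf i => Leaf i
  | GenTree.Node _ [:: a; b] => Node (tree_decode a) (tree_decode b)
  | _ => Leaf 0
  end.

Lemma tree_encodeK : cancel tree_encode tree_decode.
Proof. by elim=> //= a -> b ->. Qed.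

HB.instance Definition _ := Equality.copy tree (can_type tree_encodeK).
HB.instance Definition _ := Choice.copy tree (can_type tree_encodeK).

Fixpoint tree_eqv (s t : tree) : bool :=
  match s, t with
  | Leaf i, Leaf j => i == j
  | Node a b, Node c d =>
      (tree_eqv a c && tree_eqv b d) || (tree_eqv a d && tree_eqv b c)
  | _, _ => false
  end.

Lemma tree_eqv_refl : reflexive tree_eqv.
Proof. by elim=> [i|a IHa b IHb] /=; rewrite ?eqxx // IHa IHb. Qed.

Lemma tree_eqv_sym : symmetric tree_eqv.
Proof.
elim=> [i|a IHa b IHb] [j|c d] //=.
by rewrite !(IHa, IHb) [X in _ || X]andbC.
Qed.

Lemma tree_eqv_trans : transitive tree_eqv.
Proof.
move=> y x; elim: x y => [i|a IHa b IHb] [j|c d] [k|e f] //=.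
  by move=> /eqP-> /eqP->.
by case/orP=> /andP[h1 h2] /orP[] /andP[h3 h4]; apply/orP;
  [left|right|right|left]; apply/andP; split;
  by [apply: IHa h1 _ | apply: IHb h2 _].
Qed.

Canonical tree_equiv := EquivRel tree_eqv
  tree_eqv_refl tree_eqv_sym tree_eqv_trans.

Definition monomial : Type := {eq_quot tree_equiv}.
HB.instance Definition _ := Choice.on monomial.
HB.instance Definition _ := EqQuotient.on monomial.

Definition letter (i : nat) : monomial := \pi_monomial (Leaf i).

Definition mdot (u v : monomial) : monomial :=
  \pi_monomial (Node (repr u) (repr v)).

Fixpoint tree_fold (S : Type) (op : S -> S -> S) (x : nat -> S) (t : tree) : S :=
  match t with
  | Leaf i => x i
  | Node a b => op (tree_fold op x a) (tree_fold op x b)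
  end.

(* The magma morphism into (S, op) sending [letter i] to [x i]; meaningful for
   commutative [op]. *)
Definition mfold (S : Type) (op : S -> S -> S) (x : nat -> S) (w : monomial) : S :=
  tree_fold op x (repr w).

Lemma mdotC : commutative mdot.
Proof.
move=> u v; apply/eqmodP => /=.
by rewrite !tree_eqv_refl orbT.
Qed.

Lemma tree_fold_eqv (S : Type) (op : S -> S -> S) (x : nat -> S) (s t : tree) :
  commutative op -> tree_eqv s t -> tree_fold op x s = tree_fold op x t.
Proof.
move=> opC; elim: s t => [i|a IHa b IHb] [j|c d] //=; first by move=> /eqP->.
by case/orP=> /andP[/IHa-> /IHb->].
Qed.

Lemma mfold_pi (S : Type) (op : S -> S -> S) (x : nat -> S) (t : tree) :
  commutative op -> mfold op x (\pi_monomial t) = tree_fold op x t.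
Proof.
move=> opC; apply: tree_fold_eqv => //; apply/(@eqmodP _ tree_equiv).
exact: (reprK (\pi_monomial t)).
Qed.

Lemma mfold_letter (S : Type) (op : S -> S -> S) (x : nat -> S) (i : nat) :
  commutative op -> mfold op x (letter i) = x i.
Proof. exact: mfold_pi. Qed.

Lemma mfold_mdot (S : Type) (op : S -> S -> S) (x : nat -> S) :
  commutative op -> {morph mfold op x : u v / mdot u v >-> op u v}.
Proof. by move=> opC u v; rewrite /mdot mfold_pi. Qed.

Lemma monomial_ind (P : monomial -> Prop) :
  (forall i, P (letter i)) -> (forall u v, P u -> P v -> P (mdot u v)) ->
  forall w, P w.
Proof.
move=> Pl Pd w; rewrite -[w]reprK; elim: (repr w) => [i|a Pa b Pb].
  exact: Pl.
have -> : \pi_monomial (Node a b) = mdot (\pi a) (\pi b); last exact: Pd.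
apply/(@eqmodP _ tree_equiv) => /=; apply/orP; left.
by apply/andP; split; apply/(@eqmodP _ tree_equiv);
  rewrite [RHS](reprK (\pi_monomial _)).
Qed.

(* The system generated by the letters under [dot] and [star]. The defining
   relations, read for monomials u, v, w, u', v', rewrite every element to a
   unique normal form [Mon w] or [Star u v], and serve as computation rules of
   [dot] and [star]; [term_relations] and [term_presentation] say that this is
   the system presented by these relations. *)
Inductive term : Type := Mon of monomial | Star of monomial & monomial.

Definition term_encode (b : term) : monomial + monomial * monomial :=
  match b with Mon w => inl w | Star u v => inr (u, v) end.

Definition term_decode (s : monomial + monomial * monomial) : term :=
  match s with inl w => Mon w | inr (u, v) => Star u v end.

Lemma term_encodeK : cancel term_encode term_decode. Proof. by case. Qed.

HB.instance Definition _ := Equality.copy term (can_type term_encodeK).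
HB.instance Definition _ := Choice.copy term (can_type term_encodeK).

Definition dot (x y : term) : term :=
  match x, y with
  | Mon w, Mon w' => Mon (mdot w w')
  | Star u v, Mon w => Star u (mdot v w)
  | Mon w, Star u v => Star u (mdot w v)
  | Star u v, Star u' v' => Star (mdot u u') (mdot v v')
  end.

Definition star (x y : term) : term :=
  match x, y with
  | Mon w, Mon w' => Star w w'
  | Star u v, Mon w => Star (mdot u v) w
  | Mon u, Star v w => Star (mdot u v) w
  | Star u v, Star u' v' => Star (mdot (mdot u v) u') v'
  end.

(* [h] is the interpretation of monomials. *)
Definition star_relations (S : Type) (op st : S -> S -> S) (h : monomial -> S)
    : Prop :=
  [/\ forall u v w,
        st (st (h u) (h v)) (h w) = st (op (h u) (h v)) (h w) /\
        st (h u) (st (h v) (h w)) = st (op (h u) (h v)) (h w),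
      forall u v w,
        op (st (h u) (h v)) (h w) = st (h u) (op (h v) (h w)) /\
        op (h v) (st (h u) (h w)) = st (h u) (op (h v) (h w)),
      forall u v u' v',
        op (st (h u) (h v)) (st (h u') (h v')) =
        st (op (h u) (h u')) (op (h v) (h v'))
    & forall u v u' v',
        st (st (h u) (h v)) (st (h u') (h v')) =
        st (op (h u) (h v)) (st (h u') (h v'))].

Lemma dotC : commutative dot.
Proof.
by case=> [w|u v] [w'|u' v'] //=; rewrite mdotC // [mdot v v']mdotC.
Qed.

Lemma term_relations : star_relations dot star Mon.
Proof. by []. Qed.

Lemma term_presentation (S : Type) (op st : S -> S -> S) (x : nat -> S) :
  commutative op -> star_relations op st (mfold op x) ->
  exists! h : term -> S,
    [/\ forall i, h (Mon (letter i)) = x i,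
        {morph h : a b / dot a b >-> op a b}
      & {morph h : a b / star a b >-> st a b}].
Proof.
move=> opC [r1 r2 r3 r4]; set m := mfold op x.
have mD : {morph m : u v / mdot u v >-> op u v} by exact: mfold_mdot.
exists (fun b => match b with Mon w => m w | Star u v => st (m u) (m v) end).
split.
  split; first by move=> i; apply: mfold_letter.
  - case=> [w|u v] [w'|u' v'] /=; rewrite !mD ?r3 //.
      by rewrite (r2 u' w v').2.
    by rewrite (r2 u v w').1.
  - case=> [w|u v] [w'|u' v'] //=; rewrite !mD.
    + by rewrite (r1 w u' v').2.
    + by rewrite (r1 u v w').1.
    + by rewrite r4; have := (r1 (mdot u v) u' v').2; rewrite -/m !mD => ->.
move=> h [hl hd hs]; apply/funext.
have hM w : h (Mon w) = m w.
  elim/monomial_ind: w => [i|u v IHu IHv]; first by rewrite hl /m mfold_letter.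
  by rewrite mD -IHu -IHv -hd.
by case=> [w|u v]; rewrite -?hM // -hs.
Qed.

Definition monomial_degree (i : nat) (w : monomial) : nat :=
  mfold addn (fun j => nat_of_bool (j == i)) w.

Definition term_degree (i : nat) (b : term) : nat :=
  match b with Mon w => monomial_degree i w | Star u v => (monomial_degree i u + monomial_degree i v)%N end.

Definition term_type (b : term) : nat -> nat := fun i => term_degree i b.

(* [{malg K[term]}] is the K-vector space of finitely supported K-linear
   combinations of terms; the terms of f are the elements of [msupp f]. *)
Definition degree (K : fieldType) (i : nat) (f : {malg K[term]}) : nat :=
  \max_(b <- msupp f) term_degree i b.

Definition is_max_degree (K : fieldType) (f : {malg K[term]}) (N : nat) : Prop :=
  (exists i, degree i f = N) /\ (forall i, (degree i f <= N)%N).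

Lemma is_max_degree_exists (K : fieldType) (f : {malg K[term]}) :
  exists N, is_max_degree f N.
Proof.
pose len := mfold addn (fun=> 1%N).
have lenP i w : (monomial_degree i w <= len w)%N.
  elim/monomial_ind: w => [j|u v IHu IHv].
    by rewrite /monomial_degree /len !mfold_letter ?leq_b1 //; apply: addnC.
  rewrite /monomial_degree /len !mfold_mdot; do ?exact: addnC.
  exact: leq_add.
pose tlen b := match b with Mon w => len w | Star u v => (len u + len v)%N end.
have tlenP i b : (term_degree i b <= tlen b)%N.
  by case: b => [w|u v] /=; rewrite ?leq_add.
pose P n := `[< exists i, degree i f = n >].
have exP : exists n, P n by exists (degree 0 f); apply/asboolP; exists 0%N.
have leP n : P n -> (n <= \max_(b <- msupp f) tlen b)%N.
  move=> /asboolP[i <-]; apply/bigmax_leqP_seq => b bf _.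
  by apply: leq_trans (tlenP i b) _; apply: (@leq_bigmax_seq _ _ xpredT).
case: (ex_maxnP exP leP) => N /asboolP PN maxN; exists N; split=> // i.
by apply: maxN; apply/asboolP; exists i.
Qed.

Definition homogeneous_component (K : fieldType) (tau : nat -> nat)
    (f : {malg K[term]}) : {malg K[term]} :=
  \sum_(b <- msupp f | `[< term_type b = tau >]) << f@_b *g b >>.

Record baricAlgebra (K : fieldType) : Type := BaricAlgebra {
  carrier :> lmodType K;
  bmul : {bilinear carrier -> carrier -> carrier};
  bmulC : forall x y, bmul x y = bmul y x;
  weight : {scalar carrier};
  weightM : forall x y, weight (bmul x y) = weight x * weight y;
  weight_neq0 : exists x, weight x != 0
}.

Section Evaluation.
Variables (K : fieldType) (A : baricAlgebra K) (rho : nat -> A).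

Definition meval (w : monomial) : A := mfold (fun x y => bmul A x y) rho w.

Definition teval (b : term) : A :=
  match b with
  | Mon w => meval w
  | Star u v => weight A (meval u) *: meval v
  end.

Definition eval (f : {malg K[term]}) : A :=
  \sum_(b <- msupp f) f@_b *: teval b.

Lemma meval_mdot (u v : monomial) :
  meval (mdot u v) = bmul A (meval u) (meval v).
Proof. by apply: mfold_mdot; apply: bmulC. Qed.

Lemma teval_letter (i : nat) : teval (Mon (letter i)) = rho i.
Proof. by apply: mfold_letter; apply: bmulC. Qed.

Lemma teval_dot (x y : term) : teval (dot x y) = bmul A (teval x) (teval y).
Proof.
case: x y => [w|u v] [w'|u' v'] /=; rewrite ?meval_mdot ?weightM //.
- by rewrite linearZr_LR.
- by rewrite linearZl_LR.
- by rewrite linearZl_LR linearZr_LR scalerA.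
Qed.

Lemma teval_star (x y : term) :
  teval (star x y) = weight A (teval x) *: teval y.
Proof.
by case: x y => [w|u v] [w'|u' v'] //=;
  rewrite !meval_mdot ?weightM ?scalarZ ?scalerA.
Qed.

Lemma eval_linear : linear eval.
Proof.
move=> a f g; rewrite /eval.
have sub (D : {fset term}) (h : {malg K[term]}) : (msupp h `<=` D)%fset ->
    \sum_(b <- msupp h) h@_b *: teval b = \sum_(b <- D) h@_b *: teval b.
  move=> hD; apply: big_fset_incl => // b _ /mcoeff_outdom ->.
  by rewrite scale0r.
pose D := (msupp (a *: f + g) `|` (msupp f `|` msupp g))%fset.
rewrite (sub D) ?fsubsetUl // (sub D f) ?(sub D g); first last.
- by rewrite /D fsetUCA fsubsetUl.
- by rewrite /D fsetUA fsubsetUr.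
rewrite scaler_sumr -big_split /=; apply: eq_bigr => b _.
by rewrite mcoeffD mcoeffZ scalerDl scalerA.
Qed.

End Evaluation.

Definition verifies (K : fieldType) (A : baricAlgebra K) (f : {malg K[term]})
    : Prop :=
  forall rho : nat -> A, eval rho f = 0.

(* Main.v *)
Require Import Defs.
From mathcomp Require Import all_boot all_order all_algebra.
From mathcomp Require Import finmap monalg.
From mathcomp Require Import boolp classical_sets functions cardinality.

Import GRing.Theory.
Local Open Scope ring_scope.
Local Open Scope classical_set_scope.
Local Open Scope card_scope.

(** Replacing [rho i] by [x *: rho i] multiplies the value of a term [b] by
    [x ^+ term_degree i b].  Hence evaluating an identity at the rescaled
    assignments gives a polynomial in [x] of degree at most [N], with
    coefficients in [A], vanishing at [N + 1] distinct points; inverting the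
    Vandermonde matrix, all its coefficients vanish.  So the terms of a given
    degree in [t_i] form an identity again, and separating finitely many letters
    in turn isolates the terms of a given type. *)

Lemma not_card_le_II {T : Type} (B : set T) (n : nat) :
  ~ (B #<= `I_n) -> exists2 g : 'I_n.+1 -> T, injective g & forall i, B (g i).
Proof.
(* Reading an injection off a cardinal comparison requires a pointed type. Over an empty [T], [B] is
   empty and contradicts the hypothesis. *)
elim/Ppointed: T => T in B *; first by case; rewrite emptyE.
move=> nB; have /pcard_leP[g] : `I_n.+1 #<= B.
  have [[m Bm]|/infiniteP natB] := pselect (finite_set B); last first.
    exact: card_le_trans (subset_card_le (@subsetT _ _)) natB.
  case: (leqP m n) => [le_mn|lt_nm].
    case: nB; apply: card_le_trans (_ : `I_m #<= `I_n).
      by have /card_eqPle[] := Bm.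
    by rewrite card_le_II.
  apply: card_le_trans (_ : `I_n.+1 #<= `I_m) _; first by rewrite card_le_II.
  by have /card_eqPle[] := Bm.
exists (fun i : 'I_n.+1 => g i) => [i j gij|i]; last by apply: funS => /=.
by apply/val_inj/(@inj _ _ _ g) => //; rewrite inE /=.
Qed.

Lemma Vandermonde_unit (K : fieldType) (n : nat) (a : 'rV[K]_n) :
  injective (a 0) -> Vandermonde n a \in unitmx.
Proof.
move=> inj_a; rewrite unitmxE det_Vandermonde unitfE.
apply/prodf_neq0 => i _; apply/prodf_neq0 => j lt_ij.
rewrite subr_eq0; apply/eqP => /inj_a eq_ij.
by rewrite eq_ij ltnn in lt_ij.
Qed.

(** The unknowns [v i] are vectors, so the inverse Vandermonde matrix acts through scalars:
    weighting the [j]-th equation by [invmx M j k] and summing over [j] leaves [v k] alone. *)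
Lemma vanishing_coefficients (K : fieldType) (V : lmodType K) (n : nat)
    (a : 'I_n -> K) (v : 'I_n -> V) :
  injective a -> (forall j, \sum_(i < n) a j ^+ i *: v i = 0) ->
  forall i, v i = 0.
Proof.
move=> inj_a av0 k; pose M := Vandermonde n (\row_j a j).
have uM : M \in unitmx.
  by apply: Vandermonde_unit => i j; rewrite !mxE => /inj_a.
have MV (i : 'I_n) : \sum_j invmx M j k * a j ^+ i = (i == k)%:R.
  have /matrixP/(_ i k) := mulmxV uM; rewrite !mxE => <-.
  by apply: eq_bigr => j _; rewrite !mxE mulrC.
transitivity (\sum_j invmx M j k *: (\sum_(i < n) a j ^+ i *: v i)).
  under eq_bigr => j _.
    by rewrite scaler_sumr; under eq_bigr do rewrite scalerA; over.
  rewrite exchange_big /=; under eq_bigr do rewrite -scaler_suml MV.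
  rewrite (bigD1 k) //= eqxx scale1r big1 ?addr0 // => i /negPf->.
  exact: scale0r.
by rewrite big1 // => j _; rewrite av0 scaler0.
Qed.

Definition rescale {K : fieldType} {V : lmodType K} (i : nat) (x : K)
    (rho : nat -> V) : nat -> V :=
  fun j => if j == i then x *: rho j else rho j.

Section Rescale.
Variables (K : fieldType) (A : baricAlgebra K) (rho : nat -> A).
Variables (i : nat) (x : K).

Lemma meval_rescale (w : monomial) :
  meval (rescale i x rho) w = x ^+ monomial_degree i w *: meval rho w.
Proof.
elim/monomial_ind: w => [j|u v IHu IHv].
  rewrite /monomial_degree mfold_letter; last exact: addnC.
  rewrite /meval !mfold_letter; do ?exact: bmulC.
  by rewrite /rescale; case: eqP; rewrite ?scale1r.
rewrite !meval_mdot IHu IHv linearZl_LR linearZr_LR scalerA -exprD.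
by rewrite /monomial_degree mfold_mdot //; exact: addnC.
Qed.

(** In [Star u v] the power of [x] due to [u] comes out of the weight by linearity, so [u] counts in
    the degree just as [v] does. *)
Lemma teval_rescale (b : term) :
  teval (rescale i x rho) b = x ^+ term_degree i b *: teval rho b.
Proof.
case: b => [w|u v] /=; rewrite !meval_rescale // scalarZ !scalerA exprD.
by rewrite mulrAC.
Qed.

End Rescale.

(** [P] records the conditions imposed by the letters already treated, so that the lemma can be
    iterated. *)
Lemma separate_degree {K : fieldType} {A : baricAlgebra K} {f : {malg K[term]}}
    {N : nat} {a : 'I_N.+1 -> K} (P : pred term) (i k : nat) :
  injective a -> (degree i f <= N)%N ->
  (forall rho : nat -> A, \sum_(b <- msupp f | P b) f@_b *: teval rho b = 0) ->
  forall rho : nat -> A,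
    \sum_(b <- msupp f | P b && (term_degree i b == k)) f@_b *: teval rho b = 0.
Proof.
move=> inj_a degf Pf rho.
have degb b : b \in msupp f -> (term_degree i b < N.+1)%N.
  by move=> bf; rewrite ltnS (leq_trans _ degf) // leq_bigmax_seq.
(* This is the coefficient of [x ^+ d] in the evaluation at [rescale i x rho]. *)
pose v (d : 'I_N.+1) :=
  \sum_(b <- msupp f | P b && (term_degree i b == d)) f@_b *: teval rho b.
have v0 : forall d, v d = 0.
  apply: (vanishing_coefficients _ _ _ a) => // j.
  rewrite -[RHS](Pf (rescale i (a j) rho)).
  under eq_bigr do rewrite scaler_sumr.
  rewrite (exchange_big_dep P) => [|? ? _ /andP[]//] /=.
  rewrite big_seq_cond [RHS]big_seq_cond; apply: eq_bigr => b /andP[bf Pb].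
  rewrite (big_pred1 (Ordinal (degb b bf))) => [|d]; last first.
    by rewrite Pb eq_sym.
  by rewrite teval_rescale !scalerA mulrC.
(* For [k] above [N] no term qualifies and the sum is empty. *)
case: (ltnP k N.+1) => [lt_kN|le_Nk]; first exact: (v0 (Ordinal lt_kN)).
rewrite big_seq_cond big1 // => b /and3P[/degb + _ /eqP eq_k].
by rewrite eq_k ltnNge le_Nk.
Qed.

Lemma eval_homogeneous_component (K : fieldType) (A : baricAlgebra K)
    (rho : nat -> A) (tau : nat -> nat) (f : {malg K[term]}) :
  eval rho (homogeneous_component tau f) =
  \sum_(b <- msupp f | `[< term_type b = tau >]) f@_b *: teval rho b.
Proof.
have eval_lin := eval_linear rho.
have evalD g h : eval rho (g + h) = eval rho g + eval rho h.
  by have := eval_lin 1 g h; rewrite !scale1r.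
have eval0 : eval rho 0 = 0 by rewrite /eval msupp0 big_seq_fset0.
rewrite /homogeneous_component (big_morph _ evalD eval0).
apply: eq_bigr => b _; rewrite /eval msuppU.
case: eqP => [->|_]; first by rewrite big_seq_fset0 scale0r.
by rewrite big_seq_fset1 mcoeffUU.
Qed.

(** A type is an infinite sequence, but each term of another type differs from [tau] at some letter;
    a bound on these finitely many letters suffices. *)
Lemma separating_index (s : seq term) (tau : nat -> nat) :
  exists n, forall b, b \in s ->
    (forall i, (i < n)%N -> term_degree i b = tau i) -> term_type b = tau.
Proof.
elim: s => [|c s [n IHs]]; first by exists 0%N.
have [m cm] : exists m,
    (forall i, (i < m)%N -> term_degree i c = tau i) -> term_type c = tau.
  have [->|ne_c] := pselect (term_type c = tau); first by exists 0%N.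
  have /existsNP[m cm] : ~ forall i, term_degree i c = tau i.
    by move=> eq_c; apply/ne_c/funext.
  by exists m.+1 => /(_ m (ltnSn m)).
exists (maxn m n) => b; rewrite inE => /orP[/eqP->|bs] eq_b.
  by apply: cm => i lt_im; apply: eq_b; rewrite leq_max lt_im.
by apply: IHs bs _ => i lt_in; apply: eq_b; rewrite leq_max lt_in orbT.
Qed.

Theorem proposition8 (K : fieldType) (A : baricAlgebra K) (f : {malg K[term]})
    (N : nat) :
  2%N \notin [pchar K] ->
  verifies A f ->
  is_max_degree f N ->
  ~ ([set x : K | x != 0] #<= `I_N) ->
  forall tau : nat -> nat, verifies A (homogeneous_component tau f).
Proof.
(* Since [N] bounds the degree in every letter, the same [N.+1] points serve throughout. *)
move=> _ Af [_ degf] /not_card_le_II[a inj_a _] tau rho.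
rewrite eval_homogeneous_component.
have [n sep] := separating_index (msupp f) tau.
(* On the support of [f], being of type [tau] becomes a condition on the first [n] letters, which
   allows induction on [n] starting from [f] itself. *)
rewrite big_seq_cond (eq_bigl (fun b => (b \in msupp f) &&
  all (fun i => term_degree i b == tau i) (iota 0 n))); last first.
  move=> b; apply: andb_id2l => /sep sep_b; apply/asboolP/allP => [<- //|eq_b].
  by apply: sep_b => i lt_in; apply/eqP/eq_b; rewrite mem_iota.
rewrite -big_seq_cond.
elim: n rho {sep} => [|n IHn] rho; first exact: Af.
under eq_bigl do rewrite -addn1 iotaD all_cat /= andbT.
exact: (separate_degree _ n (tau n) inj_a (degf n) IHn rho).
Qed.
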